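(* The lattice $\Lambda_{64}$ contains precisely seven dual atoms, namely the parameter sets $$(64,2^5 4^{17} 8^1),\ (64,4^{14}8^3),\ (64,2^5 4^{10} 8^4),\ (64,4^7 8^6),\ (64,8^9),\ (64,4^{16}16^1),\ (64,2^{32}32^1).$$ Moreover, for each of these parameter sets a geometric orthogonal array exists.
   Context: An orthogonal array $OA(N, s_1^{k_1} s_2^{k_2}\cdots s_v^{k_v})$ (of strength 2) is an $N\times k$ array, $k=k_1+\cdots+k_v$, whose first $k_1$ columns have entries from $\{0,\dots,s_1-1\}$, next $k_2$ columns entries from $\{0,\dots,s_2-1\}$, etc., such that in every $N\times 2$ subarray every possible ordered pair of symbols occurs equally often as a row. Normally $2\le s_1<s_2<\cdots$, $k_i\ge1$; one also allows the trivial $OA(N,1^1)$ (a column of $N$ zeros). The symbol $(N,s_1^{k_1}\cdots)$ is a parameter set; it is realized if such an array exists. Expansive replacement: given an $OA$ with $N$ runs and a column with $S$ levels, and an orthogonal array $B$ with $S$ runs (possibly the trivial $OA(S,1^1)$), replace that column by the rows of $B$ (symbol $j$ by the $j$-th row of $B$); this includes deleting a factor and replacing an $s$-level factor by an $s'$-level one when $s'\mid s$. $P$ is dominated by $Q$ if an array with parameter set $P$ can be obtained from one with parameter set $Q$ by a finite sequence of expansive replacements. $\Lambda_N$ is the set of realized parameter sets with $N$ runs ordered by dominance, a lattice with maximum $(N,N^1)$; its dual atoms are the elements covered by $(N,N^1)$ (just below it in the Hasse diagram). Geometric arrays: for a prime power $q$ and subspaces $V_1,\dots,V_k$ of $GF(q)^n$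 such that $V_i\cap V_j=\{0\}$ for $i\neq j$ (a mixed spread of strength 2), fix labelings of each dual space $V_i^*$; the array with rows indexed by linear functionals $f$ on $GF(q)^n$ and $(f,V_i)$ entry equal to the label of $f|_{V_i}$ in $V_i^*$ is an $OA(q^n,\ldots)$ whose $i$-th column has $q^{\dim V_i}$ levels. An orthogonal array obtained in this way is called geometric. *)

(* Defs.v *)
From HB Require Import structures.
From mathcomp Require Import all_boot all_order all_algebra.
From Stdlib Require Export Relation_Operators.

Set Implicit Arguments.
Unset Strict Implicit.
Unset Printing Implicit Defensive.

(* A factor of an N-run array: its number of levels s, together with the
   column of its N entries in {0, ..., s-1}. *)
Definition factor (N : nat) := {s : nat & {ffun 'I_N -> 'I_s}}.

Definition levels (N : nat) (c : factor N) : nat := tag c.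

Definition entry (N : nat) (c : factor N) : {ffun 'I_N -> 'I_(levels c)} :=
  tagged c.

(* An N x k array, given by its k columns from left to right. *)
Definition array (N : nat) := seq (factor N).

Definition balanced (N : nat) (c : factor N) : bool :=
  [forall a, forall a',
    #|[set x | entry c x == a]| == #|[set x | entry c x == a']|].

Definition pair_balanced (N : nat) (c d : factor N) : bool :=
  [forall a, forall b, forall a', forall b',
    #|[set x | (entry c x == a) && (entry d x == b)]| ==
    #|[set x | (entry c x == a') && (entry d x == b')]|].

(* The symbol s_1^k_1 ... s_v^k_v is the sequence of the pairs (s_i, k_i). *)
Definition params := seq (nat * nat).

Definition wf_params (P : params) : bool :=
  (P == [:: (1, 1)]) ||
  [&& P != [::], sorted ltn [seq p.1 | p <- P]
    & all (fun p => (2 <= p.1) && (1 <= p.2)) P].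

Definition column_levels (P : params) : seq nat :=
  flatten [seq nseq p.2 p.1 | p <- P].

(* Balancedness of the single columns follows from that of the pairs as soon as
   there are two columns; it is what strength 2 means for one-column arrays. *)
Definition is_OA (N : nat) (P : params) (A : array N) : Prop :=
  [/\ wf_params P, [seq levels c | c <- A] = column_levels P,
      all (@balanced N) A & pairwise (@pair_balanced N) A].

Definition realized (N : nat) (P : params) : Prop :=
  exists A : array N, is_OA P A.

(* The column obtained from c by writing, in place of each symbol j, the j-th
   entry of the column d of an array with (levels c) runs. *)
Definition substitute (N : nat) (c : factor N) (d : factor (levels c)) :
    factor N :=
  Tagged (fun s => {ffun 'I_N -> 'I_s}) [ffun x => entry d (entry c x)].

(* Columns of zeros are deleted, except that one is kept if there is no other
   column, which gives the trivial array with parameters 1^1. *)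
Definition drop_trivial (N : nat) (A : array N) : array N :=
  let A' := [seq c <- A | levels c != 1] in
  if A' is [::] then take 1 A else A'.

(* The columns of the result may be reordered, as parameter sets list the
   factors by increasing number of levels. *)
Definition expansive_replacement (N : nat) (A A' : array N) : Prop :=
  exists (A1 : array N) (c : factor N) (A2 : array N)
         (R : params) (B : array (levels c)),
    [/\ A = A1 ++ c :: A2, is_OA R B
      & perm_eq A' (drop_trivial (A1 ++ map (@substitute N c) B ++ A2))].

Definition dominated (N : nat) (P Q : params) : Prop :=
  exists A A' : array N,
    [/\ is_OA Q A, is_OA P A'
      & clos_refl_trans (array N) (@expansive_replacement N) A A'].

Definition strictly_dominated (N : nat) (P Q : params) : Prop :=
  dominated N P Q /\ P <> Q.

Definition covered_by (N : nat) (P Q : params) : Prop :=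
  [/\ realized N P, realized N Q, strictly_dominated N P Q
    & ~ exists R : params, [/\ realized N R,
          strictly_dominated N P R & strictly_dominated N R Q]].

Definition dual_atom (N : nat) (P : params) : Prop :=
  covered_by N P [:: (N, 1)].

Definition dual (F : fieldType) (E : vectType F) := 'Hom(E, F^o).

Definition restriction (F : fieldType) (E : vectType F) (V : {vspace E})
    (f : dual E) : dual (subvs_of V) :=
  (f \o linfun (@vsval F E V))%VF.

Definition mixed_spread (F : fieldType) (E : vectType F) (k : nat)
    (V : 'I_k -> {vspace E}) : Prop :=
  forall i j : 'I_k, i != j -> (V i :&: V j)%VS = 0%VS.

(* The bijection rho lists the rows, and lab is the labeling of the dual of
   V i; bijectivity forces N = #|F| ^ n and levels c = #|F| ^ \dim (V i). *)
Definition geometric (N : nat) (A : array N) : Prop :=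
  exists (F : finFieldType) (n : nat)
         (V : 'I_(size A) -> {vspace 'rV[F]_n})
         (rho : 'I_N -> dual 'rV[F]_n),
    [/\ mixed_spread V, bijective rho
      & forall i : 'I_(size A), let c := tnth (in_tuple A) i in
          exists lab : dual (subvs_of (V i)) -> 'I_(levels c),
            bijective lab /\
            forall x : 'I_N, entry c x = lab (restriction (V i) (rho x))].

Definition seven_params : seq params :=
  [:: [:: (2, 5); (4, 17); (8, 1)];
      [:: (4, 14); (8, 3)];
      [:: (2, 5); (4, 10); (8, 4)];
      [:: (4, 7); (8, 6)];
      [:: (8, 9)];
      [:: (4, 16); (16, 1)];
      [:: (2, 32); (32, 1)]].

(* Main.v *)
(* A strength-2 array with N runs splits R^N into mutually orthogonal spaces of
   contrasts, one per column.  Fix a row x0 and, for weights g, sum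
   g (s [agreement with x0] - 1) over the columns: this total has mean 0, second
   moment the sum of g^2 (s - 1), and a known value at x0.  Its other values lie
   in one residue class, so none falls strictly between two consecutive members
   p and p + e of that class; summing (T - p)(T - p - e) >= 0 over the rows other
   than x0 gives a bound.  It contains Rao's bound, and for 64 runs it excludes
   4^18 8^1, 4^16 8^2, 4^11 8^4, 4^9 8^5, 4^3 8^7 and 4^2 8^8.  Every
   multiset of levels that survives is reached from one of the seven by deletions and
   the replacements 4 -> 2^3, 8 -> 2^4 4, 16 -> 4^5.  Conversely the seven meet
   Rao's bound, so a replacement producing one of them uses a saturated array, and
   going one step back from them leads only to excluded multisets or to 64^1.
   The seven arrays come from partitions of GF(2)^6 into subspaces. *)

From HB Require Import structures.
Require Import Defs.
From mathcomp Require Import all_boot all_order all_algebra.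
From mathcomp Require Import zify ring.
From Stdlib Require Import Operators_Properties.

Set Implicit Arguments.
Unset Strict Implicit.
Unset Printing Implicit Defensive.

Import Order.TTheory GRing.Theory Num.Theory.

(** * Balance by counting *)

Lemma balancedP N (c : factor N) :
  reflect (forall a, levels c * #|[set x | entry c x == a]| = N) (balanced c).
Proof.
apply: (iffP forallP) => [bal a | card_a a].
  rewrite -[RHS](card_ord N) -[RHS]sum1_card.
  rewrite (partition_big (entry c) predT) //=.
  transitivity (\sum_(b : 'I_(levels c)) #|[set x | entry c x == a]|).
    by rewrite sum_nat_const card_ord.
  apply: eq_bigr => b _.
  rewrite sum1dep_card.
  by move/forallP/(_ b)/eqP: (bal a) => ->; apply: eq_card => x; rewrite !inE.
apply/forallP => b; have a_lt := leq_ltn_trans (leq0n _) (ltn_ord a).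
by rewrite -(eqn_pmul2l a_lt) !card_a.
Qed.

Lemma pair_balancedP N (c d : factor N) :
  reflect (forall a b, levels c * levels d *
             #|[set x | (entry c x == a) && (entry d x == b)]| = N)
          (pair_balanced c d).
Proof.
apply: (iffP forallP) => [bal a b | card_ab a].
  rewrite -[RHS](card_ord N) -[RHS]sum1_card.
  rewrite (partition_big (fun x => (entry c x, entry d x)) predT) //=.
  transitivity (\sum_(p : 'I_(levels c) * 'I_(levels d))
                  #|[set x | (entry c x == a) && (entry d x == b)]|).
    by rewrite sum_nat_const card_prod !card_ord.
  apply: eq_bigr => -[a' b'] _; rewrite sum1dep_card.
  move/forallP/(_ b)/forallP/(_ a')/forallP/(_ b')/eqP: (bal a) => ->.
  by apply: eq_card => x; rewrite !inE -xpair_eqE.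
apply/forallP => b; apply/forallP => a'; apply/forallP => b'.
have a_lt := leq_ltn_trans (leq0n _) (ltn_ord a).
have b_lt := leq_ltn_trans (leq0n _) (ltn_ord b).
have ab_lt : 0 < levels c * levels d by rewrite muln_gt0 a_lt.
by rewrite -(eqn_pmul2l ab_lt) !card_ab.
Qed.

Lemma pair_balanced_sym N : symmetric (@pair_balanced N).
Proof.
move=> c d; apply/pair_balancedP/pair_balancedP => bal a b.
  by rewrite [levels d * _]mulnC -[RHS](bal b a); congr (_ * _);
    apply: eq_card => x; rewrite !inE andbC.
by rewrite [levels c * _]mulnC -[RHS](bal b a); congr (_ * _);
  apply: eq_card => x; rewrite !inE andbC.
Qed.

Definition strength2 N (A : array N) : bool :=
  all (@balanced N) A && pairwise (@pair_balanced N) A.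

Lemma is_OA_strength2 N P (A : array N) : is_OA P A -> strength2 A.
Proof. by case=> _ _ balA pairA; apply/andP. Qed.

Lemma pairwise_perm (T : eqType) (r : rel T) : symmetric r ->
  forall s t : seq T, perm_eq s t -> pairwise r s = pairwise r t.
Proof.
move=> r_sym; elim=> [|x s IHs] t st.
  by move: st; rewrite perm_sym => /perm_nilP ->.
have /rot_to[i t' eq_t] : x \in t by rewrite -(perm_mem st) mem_head.
have st' : perm_eq s t'.
  by rewrite -(perm_cons x) -eq_t perm_sym perm_rot perm_sym.
transitivity (pairwise r (rot i t)).
  by rewrite eq_t !pairwise_cons (IHs _ st') (perm_all _ st').
rewrite /rot -{3}(cat_take_drop i t) !pairwise_cat allrelC (eq_allrel r_sym).
by congr (_ && _); rewrite andbC.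
Qed.

Lemma perm_strength2 N (A B : array N) :
  perm_eq A B -> strength2 A = strength2 B.
Proof.
move=> AB; rewrite /strength2 (perm_all _ AB).
by rewrite (pairwise_perm (@pair_balanced_sym N) AB).
Qed.

Lemma subseq_strength2 N (A B : array N) :
  subseq A B -> strength2 B -> strength2 A.
Proof.
move=> AB /andP[balB pairB]; rewrite /strength2 (subseq_pairwise AB) // andbT.
by apply/allP => c /(mem_subseq AB); apply: (allP balB).
Qed.

(** Allows the columns of an array to be rearranged so that their levels come in a prescribed
    order. *)
Lemma perm_map_lift (T U : eqType) (f : T -> U) (s : seq T) (t : seq U) :
  perm_eq (map f s) t -> exists2 s', perm_eq s s' & map f s' = t.
Proof.
case: s => [|x0 s] st; first by exists [::] => //; apply/esym/perm_nilP; rewrite perm_sym.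
move: st; rewrite perm_sym => /(perm_iotaP (f x0))[I permI ->].
exists (map (nth x0 (x0 :: s)) I).
  rewrite perm_sym; apply/(perm_iotaP x0); exists I => //.
  by rewrite -(size_map f).
rewrite -map_comp; apply/eq_in_map => i; rewrite (perm_mem permI) mem_iota /=.
by rewrite add0n size_map => lt_i /=; rewrite -(nth_map _ (f x0)).
Qed.

(** Keeps only the levels of a strength-2 array, free of the format conditions on parameter sets, so
    that subarrays can be discussed through their levels alone. *)
Definition OA_levels N (M : seq nat) : Prop :=
  exists2 A : array N, strength2 A & [seq levels c | c <- A] = M.

Lemma OA_levels_sub N (M M' : seq nat) :
  (forall k, count_mem k M' <= count_mem k M) -> OA_levels N M -> OA_levels N M'.
Proof.
move=> le_count [A strA AM].
have [M1 /subseqP[m sz_m eq_M1] permM] := (count_subseqP _ _).1 le_count.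
have [A' permA A'M] : exists2 A', perm_eq (mask m A) A' & map (@levels N) A' = M'.
  by apply: perm_map_lift; rewrite map_mask AM -eq_M1 perm_sym.
exists A' => //; rewrite -(perm_strength2 permA).
by apply: subseq_strength2 strA; apply: mask_subseq.
Qed.

Lemma OA_levels_dvd N s : 0 < N -> OA_levels N [:: s] -> s %| N.
Proof.
case: N => // N _ [[|c [|d A]] //= /andP[/andP[/balancedP bal _] _] [<-]].
by rewrite -[X in _ %| X](bal (entry c ord0)) dvdn_mulr.
Qed.

Lemma OA_levels_dvd2 N s t : 0 < N -> OA_levels N [:: s; t] -> s * t %| N.
Proof.
case: N => // N _ [[|c [|d [|? A]]] //= /andP[_]] => + [<- <-].
rewrite /= !andbT => /pair_balancedP bal.
by rewrite -[X in _ %| X](bal (entry c ord0) (entry d ord0)) dvdn_mulr.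
Qed.

(** * The moment bound *)

Section Moments.

Variables (N : nat) (x0 : 'I_N).

Local Open Scope ring_scope.

Lemma sum_Posz_bool (T : finType) (p : pred T) :
  \sum_x Posz (p x) = Posz #|[set x | p x]|.
Proof.
rewrite -sum1dep_card (big_morph Posz PoszD erefl) [RHS]big_mkcond /=.
by apply: eq_bigr => x _; case: (p x).
Qed.

(** For a balanced column this is [N] times the orthogonal projection of the indicator of row [x0]
    onto the contrast space of the column. *)
Definition contrast (c : factor N) (x : 'I_N) : int :=
  Posz (levels c) * Posz (entry c x == entry c x0) - 1.

Lemma contrast_x0 c : contrast c x0 = Posz (levels c) - 1.
Proof. by rewrite /contrast eqxx mulr1. Qed.

Lemma sum_agree c : balanced c ->
  \sum_x Posz (levels c) * Posz (entry c x == entry c x0) = Posz N.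
Proof.
move/balancedP/(_ (entry c x0)) => card_c.
by rewrite -mulr_sumr sum_Posz_bool -PoszM card_c.
Qed.

Lemma sum_one : \sum_(x < N) (1 : int) = Posz N.
Proof. by rewrite big_const card_ord iter_addr_0 natz. Qed.

Lemma sum_contrast c : balanced c -> \sum_x contrast c x = 0.
Proof. by move=> bal_c; rewrite big_split sumrN /= sum_agree // sum_one subrr. Qed.

Lemma sum_contrast_sq c : balanced c ->
  \sum_x contrast c x ^+ 2 = Posz N * (Posz (levels c) - 1).
Proof.
move=> bal_c.
transitivity (\sum_x ((Posz (levels c) - 2) *
   (Posz (levels c) * Posz (entry c x == entry c x0)) + 1)).
  by apply: eq_bigr => x _; rewrite /contrast; case: eqP => _ /=; ring.
by rewrite big_split -mulr_sumr sum_agree //= sum_one; ring.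
Qed.

Lemma sum_contrast_mul c d : balanced c -> balanced d -> pair_balanced c d ->
  \sum_x contrast c x * contrast d x = 0.
Proof.
move=> bal_c bal_d /pair_balancedP/(_ (entry c x0) (entry d x0)) bal_cd.
transitivity (\sum_x (Posz (levels c * levels d) *
     Posz ((entry c x == entry c x0) && (entry d x == entry d x0))
   + (- contrast c x + (- contrast d x + - 1)))).
  apply: eq_bigr => x _; rewrite /contrast PoszM.
  by case: eqP; case: eqP => _ _ /=; ring.
rewrite !big_split -mulr_sumr sum_Posz_bool -PoszM bal_cd !sumrN /=.
by rewrite !sum_contrast // sum_one; ring.
Qed.

Variable g : nat -> int.

Definition total (A : array N) (x : 'I_N) : int :=
  \sum_(c <- A) g (levels c) * contrast c x.

Definition weight (M : seq nat) : int := \sum_(s <- M) g s * (Posz s - 1).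

Definition sq_weight (M : seq nat) : int :=
  \sum_(s <- M) g s ^+ 2 * (Posz s - 1).

Lemma total_x0 A : total A x0 = weight (map (@levels N) A).
Proof.
by rewrite /weight big_map; apply: eq_bigr => c _; rewrite contrast_x0.
Qed.

Lemma sum_total A : all (@balanced N) A -> \sum_x total A x = 0.
Proof.
move/allP => balA; rewrite exchange_big big_seq big1 //= => c /balA bal_c.
by rewrite -mulr_sumr sum_contrast // mulr0.
Qed.

(** Pythagoras: contrasts of distinct columns are orthogonal, so all cross terms vanish. *)
Lemma sum_total_sq A : strength2 A ->
  \sum_x total A x ^+ 2 = Posz N * sq_weight (map (@levels N) A).
Proof.
elim: A => [|c A IH] strA.
  by rewrite /sq_weight big_nil mulr0 big1 // => x _; rewrite /total big_nil.
have /IH {IH} : strength2 A by apply: subseq_strength2 strA; apply: subseq_cons.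
case/andP: strA => /= /andP[bal_c /allP balA] /andP[/allP pair_c _] IH.
rewrite /sq_weight big_cons mulrDr -/(sq_weight _) -IH.
transitivity (\sum_x (g (levels c) ^+ 2 * contrast c x ^+ 2 + (total A x ^+ 2 +
   \sum_(d <- A) (2 * g (levels c) * g (levels d)) * (contrast c x * contrast d x)))).
  apply: eq_bigr => x _; rewrite /total big_cons -/(total A x).
  have -> : \sum_(d <- A) (2 * g (levels c) * g (levels d)) *
       (contrast c x * contrast d x) = 2 * g (levels c) * contrast c x * total A x.
    by rewrite mulr_sumr; apply: eq_bigr => d _; ring.
  by ring.
rewrite !big_split /= exchange_big /= -mulr_sumr sum_contrast_sq //.
have -> : \sum_(d <- A) \sum_x 2 * g (levels c) * g (levels d) *
    (contrast c x * contrast d x) = 0.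
  rewrite big_seq; apply: big1 => d dA.
  rewrite -mulr_sumr sum_contrast_mul ?mulr0 //; first exact: balA.
  exact: pair_c.
by ring.
Qed.

(* The values of [total] lie in a single class modulo [e], so none of them is
   strictly between [p] and [p + e]; sum this over the rows other than [x0]. *)
Lemma total_gap A (e p : int) :
  (forall c, c \in A -> exists k, g (levels c) * Posz (levels c) = e * k) ->
  (exists k, p + \sum_(c <- A) g (levels c) = e * k) ->
  forall x, 0 <= (total A x - p) * (total A x - (p + e)).
Proof.
move=> dvd_g [k def_p] x.
have [j ->] : exists j, total A x = p + e * j.
  (* Modulo [e] a column contributes [- g (levels c)] whatever the row, because [e] divides
     [g (levels c) * levels c]. *)
  suff [j def_j] : exists j, total A x + \sum_(c <- A) g (levels c) = e * j.
    by exists (j - k); rewrite mulrBr -def_p -def_j; ring.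
  elim: A dvd_g {def_p} => [|c A IH] dvd_g.
    by exists 0; rewrite /total !big_nil mulr0.
  have [d dA|j def_j] := IH; first by apply: dvd_g; rewrite inE dA orbT.
  have [i def_i] := dvd_g c (mem_head _ _).
  exists (i * Posz (entry c x == entry c x0) + j).
  rewrite /total !big_cons [e * _]mulrDr -def_j mulrA -def_i /contrast -/(total A x).
  by ring.
(* The product is a square times [j * (j - 1)], which is nonnegative for every integer [j]. *)
have -> : (p + e * j - p) * (p + e * j - (p + e)) = e ^+ 2 * (j * (j - 1)) by ring.
by rewrite mulr_ge0 ?sqr_ge0 //; nia.
Qed.

(** The right-hand side is the sum over all rows of the nonnegative products of [total_gap], the
    linear term vanishing with the mean; the left-hand side is the term at [x0]. *)
Lemma moment_bound A (e p : int) : strength2 A ->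
  (forall c, c \in A -> exists k, g (levels c) * Posz (levels c) = e * k) ->
  (exists k, p + \sum_(c <- A) g (levels c) = e * k) ->
  (weight (map (@levels N) A) - p) * (weight (map (@levels N) A) - (p + e)) <=
  Posz N * (sq_weight (map (@levels N) A) + p * (p + e)).
Proof.
move=> strA dvd_g def_p.
have gap := total_gap dvd_g def_p.
have -> : Posz N * (sq_weight (map (@levels N) A) + p * (p + e)) =
   \sum_x (total A x - p) * (total A x - (p + e)).
  transitivity (\sum_x (total A x ^+ 2 + ((- (p + (p + e))) * total A x + p * (p + e) * 1))).
    rewrite !big_split -!mulr_sumr /= sum_total_sq // sum_total ?sum_one.
      by ring.
    by case/andP: strA.
  by apply: eq_bigr => x _; ring.
rewrite (bigD1 x0) //= total_x0 lerDl; apply: sumr_ge0 => x _; exact: gap.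
Qed.

End Moments.

(** * Feasible level multisets *)

Section Bounds.

Local Open Scope ring_scope.

Lemma OA_levels_moment N M (g : nat -> int) (e p : int) :
  (0 < N)%N -> OA_levels N M ->
  all (fun s => (e %| g s * Posz s)%Z) M ->
  (e %| p + \sum_(s <- M) g s)%Z ->
  (weight g M - p) * (weight g M - (p + e)) <=
  Posz N * (sq_weight g M + p * (p + e)).
Proof.
case: N => // N _ [A strA <-] /allP dvd_g /dvdzP[k def_k].
apply: (moment_bound ord0) => // [c cA|].
  by have /dvdzP[j ->] := dvd_g _ (map_f _ cA); exists j; rewrite mulrC.
by exists k; rewrite mulrC -def_k big_map.
Qed.

Lemma sum_nseq_cat (F : nat -> int) n s M :
  \sum_(i <- nseq n s ++ M) F i = Posz n * F s + \sum_(i <- M) F i.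
Proof. by rewrite big_cat big_nseq iter_addr_0 -mulr_natl natz. Qed.

(* Rao's bound is the gap [-1, 0] of the unweighted total. *)
Lemma rao_bound N a b c d e f : (0 < N)%N ->
  OA_levels N (nseq a 2 ++ nseq b 4 ++ nseq c 8 ++ nseq d 16 ++ nseq e 32
               ++ nseq f 64 ++ [::]) ->
  (a + 3 * b + 7 * c + 15 * d + 31 * e + 63 * f < N)%N.
Proof.
move=> N_gt0 /(@OA_levels_moment _ _ (fun=> 1) 1 (- 1) N_gt0).
rewrite /weight /sq_weight !sum_nseq_cat !big_nil dvd1z.
have -> : forall M : seq nat, all (fun s => (1 %| 1 * Posz s)%Z) M.
  by move=> M; apply/allP => s _; rewrite dvd1z.
(* Both weights equal the same sum [W], and the bound reads [(W + 1) * W <= N * W]; the case [W = 0]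
   follows from [0 < N]. *)
by move=> /(_ isT isT); nia.
Qed.

(** The hypothesis is boolean, so that each exclusion is a computation once the weights [g4], [g8],
    the modulus [e] and the lower end [p] of the gap are supplied. *)
Lemma no_OA_4_8 N k4 k8 (g4 g8 e p : int) : (0 < N)%N ->
  let w := Posz k4 * (g4 * 3) + Posz k8 * (g8 * 7) in
  let w2 := Posz k4 * (g4 ^+ 2 * 3) + Posz k8 * (g8 ^+ 2 * 7) in
  [&& (e %| g4 * 4)%Z, (e %| g8 * 8)%Z,
      (e %| p + (Posz k4 * g4 + Posz k8 * g8))%Z
    & Posz N * (w2 + p * (p + e)) < (w - p) * (w - (p + e))] ->
  ~ OA_levels N (nseq k4 4 ++ nseq k8 8 ++ [::]).
Proof.
move=> N_gt0 w w2 /and4P[dvd4 dvd8 dvd_p lt_bound] oa.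
have := @OA_levels_moment _ _ (fun s => if s == 4 then g4 else g8) e p N_gt0 oa.
rewrite /weight /sq_weight !sum_nseq_cat !big_nil !addr0 /= !all_cat !all_nseq /=.
by rewrite dvd4 dvd8 dvd_p !orbT => /(_ isT isT); rewrite leNgt lt_bound.
Qed.

End Bounds.

Lemma count_nseq_cat k n s (M : seq nat) :
  count_mem k (nseq n s ++ M) = (s == k) * n + count_mem k M.
Proof. by rewrite count_cat count_nseq. Qed.

Lemma OA64_no_4_8 M k4 k8 : OA_levels 64 M ->
  (k4, k8) \in [:: (18, 1); (16, 2); (11, 4); (9, 5); (3, 7); (2, 8)] ->
  k4 <= count_mem 4 M -> k8 <= count_mem 8 M -> False.
Proof.
move=> oa k48 le4 le8.
have {le4 le8 oa} : OA_levels 64 (nseq k4 4 ++ nseq k8 8 ++ [::]).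
  apply: OA_levels_sub oa => k; rewrite !count_nseq_cat /= addn0.
  have [<-|_] := eqVneq 4 k; first by rewrite mul1n mul0n addn0.
  by have [<-|_] := eqVneq 8 k; rewrite ?mul1n !mul0n.
move: k48; rewrite !inE !xpair_eqE => /orP[|/orP[|/orP[|/orP[|/orP[]]]]].
(* With equal weights the total is fixed modulo 4. In the last two cases, weight 2 on the 4-level
   columns makes each product of weight and level equal to 8, which gives a gap of length 8. The gap
   always contains 0, the mean of the total. *)
- by case/andP=> /eqP-> /eqP->; apply: (@no_OA_4_8 _ _ _ 1 1 4 (-3)%R).
- by case/andP=> /eqP-> /eqP->; apply: (@no_OA_4_8 _ _ _ 1 1 4 (-2)%R).
- by case/andP=> /eqP-> /eqP->; apply: (@no_OA_4_8 _ _ _ 1 1 4 (-3)%R).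
- by case/andP=> /eqP-> /eqP->; apply: (@no_OA_4_8 _ _ _ 1 1 4 (-2)%R).
- by case/andP=> /eqP-> /eqP->; apply: (@no_OA_4_8 _ _ _ 2 1 8 (-5)%R).
- by case/andP=> /eqP-> /eqP->; apply: (@no_OA_4_8 _ _ _ 2 1 8 (-4)%R).
Qed.

(** * Expansive replacements *)

Lemma mul_card_ord0 N (S : {set 'I_N}) m : N = 0 -> m * #|S| = N.
Proof.
case: N S => // S _; suff -> : #|S| = 0 by rewrite muln0.
by apply: eq_card0 => -[].
Qed.

Section Substitution.

Variables (N : nat) (c : factor N).

Lemma levels_gt0 : 0 < N -> 0 < levels c.
Proof. by move=> N_gt0; apply: leq_ltn_trans (ltn_ord (entry c (Ordinal N_gt0))). Qed.

(** Rows are counted fibre by fibre over the symbols of [c]; [q] carries the condition on a second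
    column, or is trivial. *)
Lemma card_comp_fibre (p : pred 'I_(levels c)) (q : pred 'I_N) n :
  (forall j, levels c * #|[set x | (entry c x == j) && q x]| = n) ->
  levels c * #|[set x | p (entry c x) && q x]| = #|[set j | p j]| * n.
Proof.
move=> card_j; rewrite -[#|[set x | _]|]sum1_card.
rewrite (partition_big (entry c) p) => [|x]; last by rewrite inE => /andP[].
rewrite big_distrr -sum_nat_const [RHS](eq_bigl p) => [|j]; last by rewrite inE.
apply: eq_bigr => j pj /=; rewrite -(card_j j) -sum1_card; congr (_ * _).
apply: eq_bigl => x; rewrite !inE.
by have [->|_] := eqVneq (entry c x) j; rewrite ?andbF // pj andbT.
Qed.

Lemma balanced_substitute (d : factor (levels c)) :
  balanced c -> balanced d -> balanced (substitute d).
Proof.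
move=> /balancedP bal_c /balancedP bal_d; apply/balancedP => a.
have [N0|N_gt0] := posnP N.
  exact: mul_card_ord0.
apply/eqP; rewrite -(eqn_pmul2l (levels_gt0 N_gt0)) mulnCA.
have -> : [set x | entry (substitute d) x == a] =
    [set x | (entry d (entry c x) == a) && xpredT x].
  by apply/setP => x; rewrite !inE andbT ffunE.
rewrite (@card_comp_fibre (fun j => entry d j == a) xpredT N) => [|j].
  by rewrite mulnA bal_d.
by rewrite -[RHS](bal_c j); congr (_ * _); apply: eq_card => x; rewrite !inE andbT.
Qed.

Lemma pair_balanced_substitute (d : factor (levels c)) (c' : factor N) :
  pair_balanced c c' -> balanced d -> pair_balanced (substitute d) c'.
Proof.
move=> /pair_balancedP bal_c /balancedP bal_d; apply/pair_balancedP => a b.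
have [N0|N_gt0] := posnP N.
  exact: mul_card_ord0.
apply/eqP; rewrite -(eqn_pmul2l (levels_gt0 N_gt0)) mulnCA.
have -> : [set x | (entry (substitute d) x == a) && (entry c' x == b)] =
    [set x | (entry d (entry c x) == a) && (entry c' x == b)].
  by apply/setP => x; rewrite !inE ffunE.
have c'_gt0 : 0 < levels c' by apply: leq_ltn_trans (ltn_ord b).
(* The additional factor [levels c'] clears the quotient [N %/ levels c'], which is [levels c] times
   the size of each joint fibre of [c] and [c']. *)
rewrite -(eqn_pmul2l c'_gt0); apply/eqP.
change (levels (substitute d)) with (levels d).
transitivity (levels d * (levels c' * (levels c' * (levels c *
   #|[set x | (entry d (entry c x) == a) && (entry c' x == b)]|)))); first by lia.
transitivity (levels d * (levels c' * (#|[set j | entry d j == a]| * N))); last first.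
  by rewrite mulnCA [levels d * _]mulnA bal_d.
congr (_ * (_ * _)).
have card_j j : levels c * #|[set x | (entry c x == j) && (entry c' x == b)]| = N %/ levels c'.
  by rewrite -[X in X %/ _](bal_c j b) -mulnA mulnCA mulKn.
rewrite (card_comp_fibre (fun j => entry d j == a) card_j) mulnCA.
congr (_ * _); rewrite -(card_j (entry c (Ordinal N_gt0))).
by rewrite -[RHS](bal_c (entry c (Ordinal N_gt0)) b); lia.
Qed.

Lemma pair_balanced_substitute2 (d d' : factor (levels c)) :
  balanced c -> pair_balanced d d' -> pair_balanced (substitute d) (substitute d').
Proof.
move=> /balancedP bal_c /pair_balancedP bal_d; apply/pair_balancedP => a b.
have [N0|N_gt0] := posnP N.
  exact: mul_card_ord0.
apply/eqP; rewrite -(eqn_pmul2l (levels_gt0 N_gt0)) mulnCA.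
have -> : [set x | (entry (substitute d) x == a) && (entry (substitute d') x == b)] =
    [set x | ((entry d (entry c x) == a) && (entry d' (entry c x) == b)) && xpredT x].
  by apply/setP => x; rewrite !inE !ffunE andbT.
rewrite (@card_comp_fibre (fun j => (entry d j == a) && (entry d' j == b)) xpredT N).
  by rewrite mulnA bal_d.
by move=> j; rewrite -[RHS](bal_c j); congr (_ * _); apply: eq_card => x;
  rewrite !inE andbT.
Qed.

End Substitution.

Lemma strength2_replace N (A1 A2 : array N) c (B : array (levels c)) :
  strength2 (A1 ++ c :: A2) -> strength2 B ->
  strength2 (A1 ++ map (@substitute N c) B ++ A2).
Proof.
move=> strA /andP[/allP balB pairB].
have perm_out (B' : array N) : perm_eq (A1 ++ B' ++ A2) (B' ++ A1 ++ A2).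
  by rewrite perm_catCA.
rewrite (perm_strength2 (perm_out _)).
have {strA} := strA; rewrite -cat1s (perm_strength2 (perm_out _)).
move/andP => /= [/andP[bal_c balA] /andP[/allP pair_c pairA]].
rewrite /strength2 all_cat balA andbT pairwise_cat pairA andbT pairwise_map.
apply/and3P; split.
- by apply/allP => _ /mapP[d /balB bal_d ->]; apply: balanced_substitute.
- apply/allrelP => _ c' /mapP[d /balB bal_d ->] /pair_c pair_cc'.
  exact: pair_balanced_substitute.
- by apply: sub_pairwise pairB => d d'; apply: pair_balanced_substitute2.
Qed.

Definition drop_ones (L : seq nat) : seq nat :=
  let L' := [seq s <- L | s != 1] in if L' is [::] then take 1 L else L'.

Lemma levels_drop_trivial N (A : array N) :
  map (@levels N) (drop_trivial A) = drop_ones (map (@levels N) A).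
Proof.
rewrite /drop_trivial /drop_ones filter_map.
by case: [seq c <- A | _] => [|c A'] //=; rewrite map_take.
Qed.

Lemma drop_trivial_subseq N (A : array N) : subseq (drop_trivial A) A.
Proof.
rewrite /drop_trivial; have := filter_subseq (fun c => levels c != 1) A.
by case: filter => // _; apply: take_subseq.
Qed.

Lemma count_drop_ones k L : k != 1 -> count_mem k (drop_ones L) = count_mem k L.
Proof.
move=> k1; have eq_k : count_mem k [seq s <- L | s != 1] = count_mem k L.
  rewrite count_filter; apply: eq_count => s /=.
  by have [->|] := eqVneq s k.
rewrite /drop_ones -eq_k; case E: [seq s <- L | _] => [|s L'] //.
apply/count_memPn; apply: contraFN (in_nil k) => /mem_take kL.
by rewrite -E mem_filter k1.
Qed.

Lemma drop_ones_id L : 1 \notin L -> drop_ones L = L.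
Proof.
move=> L1; rewrite /drop_ones (_ : filter _ _ = L); first by case: L {L1}.
by apply/all_filterP/allP => s sL; apply: contraNneq L1 => <-.
Qed.

Lemma perm_drop_ones L L' : perm_eq L L' -> perm_eq (drop_ones L) (drop_ones L').
Proof.
move=> LL'; have := perm_filter (fun s => s != 1) LL'; rewrite /drop_ones.
case E: [seq s <- L | _] => [|s K]; case E': [seq s <- L' | _] => [|s' K'] //.
- move=> _.
  (* When nothing survives the filter, both lists consist of ones and have the same length, so their
     first entries agree. *)
  have all1 (K : seq nat) : [seq s <- K | s != 1] = [::] -> K = nseq (size K) 1.
    move=> K1; apply/all_pred1P/allP => s sK /=; apply: contraT => s1.
    by have := mem_filter (fun s => s != 1) s K; rewrite K1 sK s1.
  by rewrite (all1 _ E) (all1 _ E') (perm_size LL').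
- by move/perm_size.
- by move/perm_size.
Qed.

Lemma expansive_replacement_strength2 N (A A' : array N) :
  expansive_replacement A A' -> strength2 A -> strength2 A'.
Proof.
case=> [A1 [c [A2 [R [B [-> /is_OA_strength2 strB permA]]]]]] strA.
rewrite (perm_strength2 permA); apply: subseq_strength2 (drop_trivial_subseq _) _.
exact: strength2_replace.
Qed.

(** Level 1 is left out because trivial columns may be dropped; adding [s == k] on the left avoids
    truncated subtraction. *)
Lemma expansive_replacement_counts N (A A' : array N) :
  expansive_replacement A A' ->
  exists s M, [/\ s \in map (@levels N) A, OA_levels s M
    & forall k, k != 1 ->
        count_mem k (map (@levels N) A') + (s == k) =
        count_mem k (map (@levels N) A) + count_mem k M].
Proof.
case=> [A1 [c [A2 [R [B [-> /is_OA_strength2 strB permA]]]]]].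
exists (levels c), (map (@levels _) B); split; last 1 first.
- move=> k k1; rewrite (permP (perm_map _ permA)) levels_drop_trivial.
  rewrite count_drop_ones // !map_cat !count_cat /= -map_comp.
  have -> : [seq (@levels N \o @substitute N c) i | i <- B] = map (@levels _) B by [].
  by lia.
- by rewrite map_cat mem_cat mem_head orbT.
- by exists B.
Qed.

(** * Reachable level multisets *)

Definition reaches N (A : array N) (M : seq nat) : Prop :=
  exists A' : array N, [/\ clos_refl_trans (array N) (@expansive_replacement N) A A',
    strength2 A' & perm_eq (map (@levels N) A') M].

Lemma reaches_perm N (A : array N) M M' :
  perm_eq M M' -> reaches A M -> reaches A M'.
Proof.
by move=> MM' [A' [AA' strA' A'M]]; exists A'; split=> //; apply: perm_trans MM'.
Qed.

(** Unlike in [reaches], the levels come out in the exact order of [M'], as [is_OA] demands of the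
    last array of a chain. *)
Lemma reaches_step N (A : array N) s M R (B : array s) M' :
  reaches A (s :: M) -> is_OA R B ->
  perm_eq (drop_ones (column_levels R ++ M)) M' ->
  exists A', [/\ clos_refl_trans (array N) (@expansive_replacement N) A A',
    strength2 A' & map (@levels N) A' = M'].
Proof.
case=> [A0 [AA0 strA0 A0M]] oaB permM'.
have /mapP[c cA0 def_s] : s \in map (@levels N) A0.
  by rewrite (perm_mem A0M) mem_head.
move: B oaB A0M; rewrite {s}def_s => B oaB A0M.
have [A1 [A2 def_A0]] : exists A1 A2, A0 = A1 ++ c :: A2.
  by case/splitPr: cA0 => A1 A2; exists A1, A2.
set A3 := drop_trivial (A1 ++ map (@substitute N c) B ++ A2).
have strA3 : strength2 A3.
  apply: subseq_strength2 (drop_trivial_subseq _) _.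
  by apply: strength2_replace; rewrite -?def_A0 //; apply: is_OA_strength2 oaB.
have [A4 permA4 A4M'] : exists2 A4, perm_eq A3 A4 & map (@levels N) A4 = M'.
  apply: perm_map_lift; apply: perm_trans permM'.
  rewrite levels_drop_trivial perm_drop_ones // !map_cat -map_comp.
  have -> : [seq (@levels N \o @substitute N c) i | i <- B] = column_levels R.
    by case: oaB => _ <-.
  rewrite perm_catCA perm_cat2l -(perm_cons (levels c)).
  by move: A0M; rewrite def_A0 map_cat /=; apply: perm_trans; rewrite perm_sym perm_catC /= perm_cons perm_catC.
exists A4; split=> //; last by rewrite -(perm_strength2 permA4).
apply: rt_trans AA0 _; apply: rt_step.
by exists A1, c, A2, R, B; split=> //; rewrite perm_sym.
Qed.

(** * Linear columns *)

(* Vectors of GF(2)^6 and linear functionals on it are both encoded by the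
   numbers below 64, least significant bit first. *)
Definition bit (x i : nat) : bool := odd (x %/ 2 ^ i).

Definition dot (x b : nat) : bool :=
  foldr (fun i => addb (bit x i && bit b i)) false (iota 0 6).

Definition code (t : seq bool) : nat :=
  foldr (fun (b : bool) n => b + n.*2) 0 t.

Lemma code_lt t : code t < 2 ^ size t.
Proof. by elim: t => //= b t; rewrite expnS; case: b; lia. Qed.

Lemma code_inj t t' : size t = size t' -> code t = code t' -> t = t'.
Proof.
elim: t t' => [|b t IH] [|b' t'] //= [sz_t] eq_code.
have eq_b : b = b'.
  by have := congr1 odd eq_code; rewrite !oddD !odd_double !addbF !oddb.
by rewrite eq_b (IH t') //; move: eq_code; rewrite eq_b; lia.
Qed.

Definition label (bs : seq nat) (x : nat) : nat := code (map (dot x) bs).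

Lemma label_lt bs x : label bs x < 2 ^ size bs.
Proof. by rewrite -(size_map (dot x)) code_lt. Qed.

(** The list [bs] stands for a basis of a subspace: the values of a functional on it encode its
    restriction. For [N = 2 ^ m] with [m < 6] the rows are the functionals that ignore all but the
    first [m] coordinates. *)
Definition linear_column N (bs : seq nat) : factor N :=
  Tagged (fun s => {ffun 'I_N -> 'I_s}) [ffun x : 'I_N => Ordinal (label_lt bs x)].

(** Balance is restated on lists of numbers so that it can be decided by evaluation. *)
Definition balanced_check N (bs : seq nat) : bool :=
  let t := map (label bs) (iota 0 N) in
  all (fun a => 2 ^ size bs * count (pred1 a) t == N) (iota 0 (2 ^ size bs)).

Definition pair_check N (bs bs' : seq nat) : bool :=
  let t := [seq (label bs x, label bs' x) | x <- iota 0 N] in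
  all (fun a => all (fun b =>
      2 ^ size bs * 2 ^ size bs' * count (pred1 (a, b)) t == N)
    (iota 0 (2 ^ size bs'))) (iota 0 (2 ^ size bs)).

Definition spread_check N (S : seq (seq nat)) : bool :=
  all (balanced_check N) S && pairwise (pair_check N) S.

Lemma card_count_iota N (p : pred nat) :
  #|[set x : 'I_N | p x]| = count p (iota 0 N).
Proof.
by rewrite -val_enum_ord count_map cardsE cardE size_filter -enumT.
Qed.

Lemma mem_iota_ord n (i : 'I_n) : val i \in iota 0 n.
Proof. by rewrite mem_iota /= ltn_ord. Qed.

Lemma linear_columns_strength2 N S :
  spread_check N S -> strength2 (map (linear_column N) S).
Proof.
case/andP=> balS pairS; rewrite /strength2 all_map pairwise_map.
apply/andP; split.
  apply: sub_all balS => bs /allP bal /=; apply/balancedP => a.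
  have /eqP : 2 ^ size bs * count (pred1 (val a)) (map (label bs) (iota 0 N)) == N.
    exact: bal (mem_iota_ord a).
  rewrite count_map -card_count_iota => cnt; rewrite -[RHS]cnt; congr (_ * _).
  by apply: eq_card => x; rewrite !inE ffunE.
apply: sub_pairwise pairS => bs bs' /allP bal /=; apply/pair_balancedP => a b.
have /eqP := allP (bal _ (mem_iota_ord a)) _ (mem_iota_ord b).
rewrite count_map -card_count_iota => cnt; rewrite -[RHS]cnt; congr (_ * _).
by apply: eq_card => x; rewrite !inE !ffunE -[RHS]xpair_eqE.
Qed.

Lemma levels_linear_columns N S :
  map (@levels N) (map (linear_column N) S) = [seq 2 ^ size bs | bs <- S].
Proof. by rewrite -map_comp. Qed.

Lemma linear_columns_OA N S P : spread_check N S -> wf_params P ->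
  [seq 2 ^ size bs | bs <- S] = column_levels P ->
  is_OA P (map (linear_column N) S).
Proof.
move=> /linear_columns_strength2/andP[balS pairS] wfP lev_S.
by split; rewrite ?levels_linear_columns.
Qed.

(** Each inner list is a basis of one subspace, and together the subspaces partition the nonzero
    vectors of GF(2)^6, since the sum of all [2 ^ size bs - 1] is 63. The default branch serves the
    last parameter set: a hyperplane and the 32 vectors outside it. *)
Definition spread_of (P : params) : seq (seq nat) :=
  match index P seven_params with
  | 0 => [:: [:: 24]; [:: 40]; [:: 50]; [:: 60]; [:: 62]; [:: 1; 58]; [:: 4; 11];
      [:: 6; 51]; [:: 21; 33]; [:: 23; 7]; [:: 25; 38]; [:: 3; 32]; [:: 29; 45];
      [:: 9; 5]; [:: 31; 34]; [:: 19; 8]; [:: 47; 30]; [:: 13; 39]; [:: 17; 41];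
      [:: 10; 36]; [:: 44; 26]; [:: 2; 20]; [:: 14; 18; 37]]
  | 1 => [:: [:: 1; 44]; [:: 10; 52]; [:: 14; 6]; [:: 38; 7]; [:: 16; 34];
      [:: 37; 29]; [:: 48; 9]; [:: 23; 15]; [:: 3; 17]; [:: 11; 49]; [:: 32; 21];
      [:: 13; 35]; [:: 4; 26]; [:: 27; 39]; [:: 5; 25; 42]; [:: 2; 20; 41];
      [:: 12; 19; 36]]
  | 2 => [:: [:: 14]; [:: 17]; [:: 30]; [:: 44]; [:: 45]; [:: 2; 61]; [:: 5; 33];
      [:: 47; 10]; [:: 8; 3]; [:: 29; 4]; [:: 19; 7]; [:: 32; 21]; [:: 22; 42];
      [:: 39; 31]; [:: 35; 16]; [:: 6; 26; 40]; [:: 9; 18; 34]; [:: 15; 23; 38];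
      [:: 1; 12; 54]]
  | 3 => [:: [:: 1; 4]; [:: 10; 34]; [:: 11; 52]; [:: 43; 22]; [:: 9; 7];
      [:: 47; 23]; [:: 16; 15]; [:: 6; 26; 32]; [:: 8; 21; 36]; [:: 12; 18; 37];
      [:: 3; 24; 45]; [:: 2; 17; 33]; [:: 13; 20; 39]]
  | 4 => [:: [:: 1; 14; 22]; [:: 2; 28; 44]; [:: 4; 27; 35]; [:: 5; 8; 51];
      [:: 10; 16; 37]; [:: 9; 20; 32]; [:: 3; 17; 40]; [:: 6; 19; 34];
      [:: 7; 11; 33]]
  | 5 => [:: [:: 16; 43]; [:: 17; 40]; [:: 20; 42]; [:: 23; 38]; [:: 28; 41];
      [:: 35; 19]; [:: 21; 47]; [:: 27; 44]; [:: 30; 45]; [:: 33; 29]; [:: 25; 36];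
      [:: 18; 32]; [:: 37; 26]; [:: 34; 22]; [:: 39; 31]; [:: 54; 24];
      [:: 1; 2; 4; 8]]
  | _ => rcons [seq [:: b] | b <- iota 32 32] [:: 1; 2; 4; 8; 16]
  end.

Lemma spread_of_check :
  all (fun P => [&& wf_params P, spread_check 64 (spread_of P)
    & [seq 2 ^ size bs | bs <- spread_of P] == column_levels P]) seven_params.
Proof. by vm_compute. Qed.

Lemma seven_OA P : P \in seven_params ->
  is_OA P (map (linear_column 64) (spread_of P)).
Proof.
by move=> /(allP spread_of_check)/and3P[wfP chk /eqP]; apply: linear_columns_OA.
Qed.

(** The three replacing arrays also come from partitions: the nonzero vectors of GF(2)^2; a plane of
    GF(2)^3 with the four vectors outside it; a spread of five planes in GF(2)^4. *)
Lemma OA4_2 : is_OA [:: (2, 3)] (map (linear_column 4) [:: [:: 1]; [:: 2]; [:: 3]]).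
Proof. exact: linear_columns_OA. Qed.

Lemma OA8_2_4 : is_OA [:: (2, 4); (4, 1)]
  (map (linear_column 8) [:: [:: 4]; [:: 5]; [:: 6]; [:: 7]; [:: 1; 2]]).
Proof. exact: linear_columns_OA. Qed.

Lemma OA16_4 : is_OA [:: (4, 5)]
  (map (linear_column 16)
     [:: [:: 1; 2]; [:: 4; 8]; [:: 5; 10]; [:: 6; 11]; [:: 7; 9]]).
Proof. exact: linear_columns_OA. Qed.

(** * Geometric arrays over GF(2) *)

Section Geometric.

Local Open Scope ring_scope.

Lemma F2_natr (a : 'F_2) : a = (a != 0)%:R.
Proof. by case: a => [[|[|m]] lt_m] //; apply: val_inj. Qed.

Lemma F2_natr_addb (b b' : bool) : (b (+) b')%:R = b%:R + b'%:R :> 'F_2.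
Proof. by case: b; case: b'; apply: val_inj. Qed.

Definition vec (b : nat) : 'rV['F_2]_6 := \row_i (bit b i)%:R.

Definition functional (x : nat) (v : 'rV['F_2]_6) : ('F_2)^o :=
  \sum_(i < 6) (bit x i)%:R * v 0 i.

Lemma functional_is_linear x : linear (functional x).
Proof.
move=> k u v; rewrite /functional scaler_sumr -big_split; apply: eq_bigr => i _.
by rewrite !mxE mulrDr mulrCA.
Qed.

HB.instance Definition _ x := GRing.isLinear.Build 'F_2 'rV['F_2]_6 ('F_2)^o _
  (functional x) (functional_is_linear x).

Definition row_functional (x : nat) : dual 'rV['F_2]_6 := linfun (functional x).

Lemma row_functionalE x v : row_functional x v = functional x v.
Proof. exact: lfunE. Qed.

Lemma functional_vec x b : functional x (vec b) = (dot x b)%:R.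
Proof.
rewrite /functional.
transitivity (\sum_(i < 6) (bit x i && bit b i)%:R : 'F_2).
  by apply: eq_bigr => i _; rewrite mxE -natrM mulnb.
rewrite -(big_mkord xpredT (fun i => (bit x i && bit b i)%:R)) /index_iota /dot.
elim: (iota _ _) => [|i r IH]; first by rewrite big_nil.
by rewrite big_cons IH /= F2_natr_addb.
Qed.

Lemma functional_vec_neq0 x b : (functional x (vec b) != 0) = dot x b.
Proof. by rewrite functional_vec; case: (dot x b). Qed.

Lemma bit_pow2 (i j : 'I_6) : bit (2 ^ i) j = (i == j).
Proof.
have chk : all (fun i => all (fun j => bit (2 ^ i) j == (i == j)) (iota 0 6))
  (iota 0 6) by vm_compute.
exact: eqP (allP (allP chk _ (mem_iota_ord i)) _ (mem_iota_ord j)).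
Qed.

Lemma bit_code t i : bit (code t) i = nth false t i.
Proof.
elim: i t => [|i IH] [|b t] //=; rewrite /bit ?div0n //.
  by rewrite divn1 oddD odd_double addbF oddb.
by rewrite expnS divnMA -IH /bit; congr (odd (_ %/ _)); case: b; lia.
Qed.

Lemma vec_pow2 (i : 'I_6) : vec (2 ^ i) = delta_mx 0 i.
Proof. by apply/rowP => j; rewrite !mxE bit_pow2 eq_sym. Qed.

Lemma functional_pow2 (i : 'I_6) v : functional (2 ^ i) v = v 0 i.
Proof.
rewrite /functional (bigD1 i) //= bit_pow2 eqxx mul1r big1 ?addr0 // => j.
by rewrite bit_pow2 eq_sym => /negbTE->; rewrite mul0r.
Qed.

Definition functional_code (f : dual 'rV['F_2]_6) : seq bool :=
  [seq f (vec (2 ^ i)%N) != 0 | i <- iota 0 6].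

Lemma functional_code_lt f : (code (functional_code f) < 64)%N.
Proof. by have := code_lt (functional_code f); rewrite size_map. Qed.

(** The inverse reads the bits of the row number off the values of a functional on the unit
    vectors. *)
Lemma row_functional_bij : bijective (fun x : 'I_64 => row_functional x).
Proof.
exists (fun f => Ordinal (functional_code_lt f)) => [x | f].
  apply: val_inj; change (code (functional_code (row_functional x)) = x).
  have chk : all (fun x => code [seq dot x (2 ^ i)%N | i <- iota 0 6] == x) (iota 0 64).
    by vm_compute.
  rewrite -[RHS](eqP (allP chk _ (mem_iota_ord x))); congr code.
  by apply: eq_map => i; rewrite row_functionalE functional_vec_neq0.
apply/lfunP => v; rewrite row_functionalE /functional [in RHS](row_sum_delta v).
rewrite linear_sum; apply: eq_bigr => i _; rewrite linearZ -vec_pow2.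
rewrite (bit_code (functional_code f)) (nth_map 0%N) ?size_iota // nth_iota // add0n -F2_natr.
exact: mulrC.
Qed.

Definition span_vec (bs : seq nat) : {vspace 'rV['F_2]_6} := <<map vec bs>>%VS.

Definition dual_code bs (f : dual (subvs_of (span_vec bs))) : seq bool :=
  [seq f (vsproj (span_vec bs) (vec b)) != 0 | b <- bs].

Lemma dual_code_lt bs (f : dual (subvs_of (span_vec bs))) :
  (code (dual_code f) < 2 ^ size bs)%N.
Proof. by rewrite -(size_map (fun b => f (vsproj (span_vec bs) (vec b)) != 0)) code_lt. Qed.

Definition dual_label bs (f : dual (subvs_of (span_vec bs))) : 'I_(2 ^ size bs) :=
  Ordinal (dual_code_lt f).

(** A functional is determined by its values on a spanning family, and over GF(2) a value is
    determined by whether it vanishes. *)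
Lemma dual_label_inj bs : injective (@dual_label bs).
Proof.
move=> f f' /(congr1 val) /= eq_code; apply/lfunP => u.
have eq_b b : b \in bs -> f (vsproj _ (vec b)) = f' (vsproj _ (vec b)).
  move=> b_bs; rewrite [LHS]F2_natr [RHS]F2_natr; congr (_%:R); congr nat_of_bool.
  have /eq_in_map : dual_code f = dual_code f'.
    by apply: code_inj; rewrite ?size_map.
  exact.
rewrite -[u]vsvalK (@coord_span _ _ _ (in_tuple (map vec bs)) (vsval u)); last first.
  exact: subvsP.
rewrite !linear_sum; apply: eq_bigr => i _; rewrite !linearZ /=; congr (_ *: _).
have lt_i : (i < size bs)%N by rewrite -(size_map vec) ltn_ord.
by rewrite (nth_map 0%N) // eq_b ?mem_nth.
Qed.

Lemma restrictionE (V : {vspace 'rV['F_2]_6}) f u :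
  restriction V f u = f (vsval u).
Proof. by rewrite comp_lfunE lfunE. Qed.

Lemma dual_label_restriction bs x :
  dual_label (restriction (span_vec bs) (row_functional x)) = Ordinal (label_lt bs x).
Proof.
apply: val_inj; congr code; apply/eq_in_map => b b_bs.
by rewrite restrictionE vsprojK ?memv_span ?map_f // row_functionalE functional_vec_neq0.
Qed.

Lemma entry_linear_column N bs (x : 'I_N) :
  entry (linear_column N bs) x =
  dual_label (restriction (span_vec bs) (row_functional x)).
Proof. by rewrite dual_label_restriction ffunE. Qed.

(* Balance makes every label occur, hence the labeling is onto. *)
Lemma dual_label_bij N bs : (0 < N)%N -> balanced (linear_column N bs) ->
  bijective (@dual_label bs).
Proof.
move=> N_gt0 /balancedP bal.
have onto a : exists x : 'I_N, entry (linear_column N bs) x == a.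
  have /card_gt0P[x] : (0 < #|[set x | entry (linear_column N bs) x == a]|)%N.
    by move: N_gt0; rewrite -{1}(bal a) muln_gt0 => /andP[].
  by rewrite inE; exists x.
exists (fun a => restriction (span_vec bs) (row_functional (xchoose (onto a)))).
  move=> f; apply: dual_label_inj; rewrite -entry_linear_column.
  exact: eqP (xchooseP (onto _)).
by move=> a; rewrite -entry_linear_column; exact: eqP (xchooseP (onto a)).
Qed.

(* A functional may be prescribed independently on the two spans, so it can be
   made to vanish on the second; hence all functionals vanish on the intersection. *)
Lemma span_vec_cap0 bs bs' :
  pair_balanced (linear_column 64 bs) (linear_column 64 bs') ->
  (span_vec bs :&: span_vec bs')%VS = 0%VS.
Proof.
move/pair_balancedP=> bal; apply/eqP; rewrite -subv0; apply/subvP => w.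
rewrite memv_cap memv0 => /andP[w_bs w_bs']; apply/eqP/rowP => i.
have lt_i : (2 ^ i < 64)%N by rewrite (ltn_exp2l _ 6).
(* Row [2 ^ i] is the [i]-th coordinate and row 0 the zero functional. Balance yields a functional
   agreeing with the former on the first span and with the latter on the second, so coordinate [i]
   of [w] is 0. *)
have {bal} := bal (entry _ (Ordinal lt_i)) (entry _ ord0).
set S := [set x | _] => card_S.
have /card_gt0P[x] : (0 < #|S|)%N.
  by case: #|S| card_S => //; rewrite muln0.
rewrite inE !entry_linear_column => /andP[/eqP/dual_label_inj eq_x /eqP/dual_label_inj eq_x'].
have res y (V : {vspace 'rV['F_2]_6}) : w \in V -> functional y w = restriction V (row_functional y) (vsproj V w).
  by move=> wV; rewrite restrictionE vsprojK // row_functionalE.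
rewrite -functional_pow2 (res _ _ w_bs) -eq_x -(res _ _ w_bs) (res _ _ w_bs') eq_x'.
rewrite -(res _ _ w_bs') /functional mxE big1 // => j _.
by rewrite /bit div0n mul0r.
Qed.

Lemma linear_columns_geometric S : spread_check 64 S ->
  geometric (map (linear_column 64) S).
Proof.
move/linear_columns_strength2; set A := map _ S => /andP[balA pairA].
have sz_A : size A = size S by rewrite size_map.
have tnthA (i : 'I_(size A)) :
    tnth (in_tuple A) i = linear_column 64 (nth [::] S i).
  by rewrite (tnth_nth (linear_column 64 [::])) (nth_map [::]) // -sz_A.
exists 'F_2, 6%N, (fun i => span_vec (nth [::] S i)), (fun x => row_functional x).
split=> [i j neq_ij||i]; last 1 first.
- rewrite tnthA; exists (@dual_label _); split; last exact: entry_linear_column.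
  apply: (@dual_label_bij 64) => //.
  by rewrite -tnthA; apply: (allP balA _ (mem_tnth i (in_tuple A))).
- apply: span_vec_cap0; rewrite -!tnthA.
  wlog lt_ij : i j neq_ij / (i < j)%N.
    move=> wlt; have := neq_ij; rewrite neq_ltn => /orP[|lt_ji]; first exact: wlt.
    by rewrite pair_balanced_sym wlt // eq_sym.
  rewrite !(tnth_nth (linear_column 64 [::])).
  by apply: (pairwiseP _ pairA) => //; rewrite inE ltn_ord.
- exact: row_functional_bij.
Qed.

End Geometric.

(** * Parameter sets and their level multisets *)

Lemma wf_params_sorted P : wf_params P ->
  sorted ltn (map fst P) /\ all (fun p => 0 < p.2) P.
Proof.
case/orP=> [/eqP-> //|/and3P[_ srtP posP]]; split=> //.
by apply: sub_all posP => p /andP[].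
Qed.

Lemma mem_column_levels P k : all (fun p => 0 < p.2) P ->
  (k \in column_levels P) = (k \in map fst P).
Proof.
elim: P => //= p P IH /andP[p_gt0 /IH {}IH].
by rewrite /column_levels /= mem_cat mem_nseq p_gt0 inE -IH.
Qed.

Lemma count_column_levels P p : uniq (map fst P) -> p \in P ->
  count_mem p.1 (column_levels P) = p.2.
Proof.
elim: P => //= q P IH /andP[q_notin uniqP].
rewrite /column_levels /= count_cat count_nseq inE => /orP[/eqP->|pP].
  rewrite /= eqxx mul1n (count_memPn _) ?addn0 //.
  apply: contra q_notin => /flatten_mapP[r rP]; rewrite mem_nseq => /andP[_ /eqP->].
  exact: map_f.
rewrite -/(column_levels P) IH //= (_ : q.1 == p.1 = false) //.
by apply: contraNF q_notin => /eqP->; apply: map_f.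
Qed.

(** The strictly increasing levels of a parameter set are recovered from the support of the
    multiset, the exponents from its multiplicities. *)
Lemma wf_params_inj P Q : wf_params P -> wf_params Q ->
  perm_eq (column_levels P) (column_levels Q) -> P = Q.
Proof.
move=> /wf_params_sorted[srtP posP] /wf_params_sorted[srtQ posQ] permPQ.
have eq_fst : map fst P = map fst Q.
  apply: (irr_sorted_eq ltn_trans ltnn) => // k.
  by rewrite -!mem_column_levels // (perm_mem permPQ).
have canon R : sorted ltn (map fst R) ->
    R = [seq (k, count_mem k (column_levels R)) | k <- map fst R].
  move=> srtR; rewrite -map_comp -[LHS]map_id; apply/eq_in_map => p pR /=.
  rewrite count_column_levels -?surjective_pairing //.
  exact: (sorted_uniq ltn_trans ltnn).
rewrite (canon P) // (canon Q) // eq_fst; apply: eq_map => k.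
by rewrite (permP permPQ).
Qed.

Lemma one_notin_column_levels P : wf_params P -> P != [:: (1, 1)] ->
  1 \notin column_levels P.
Proof.
rewrite /wf_params => /orP[-> //|/and3P[_ _ /allP geP]] _.
by apply/negP => /flatten_mapP[p /geP/andP[p_ge2 _]]; rewrite mem_nseq => /andP[_ /eqP eq1]; rewrite -eq1 in p_ge2.
Qed.

Lemma drop_ones_column_levels P : wf_params P ->
  drop_ones (column_levels P) = column_levels P.
Proof.
have [-> //|P1 wfP] := eqVneq P [:: (1, 1)].
by rewrite drop_ones_id // one_notin_column_levels.
Qed.

Lemma column_levels_neq_nil P : wf_params P -> column_levels P != [::].
Proof.
case/orP=> [/eqP-> //|/and3P[]]; case: P => [//|p P] _ _ /= /andP[/andP[_]].
by rewrite /column_levels /=; case: p.2.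
Qed.

Lemma column_levels_gt0 P s : wf_params P -> s \in column_levels P -> 0 < s.
Proof.
move=> wfP sP; have [P1|P1] := eqVneq P [:: (1, 1)].
  by move: sP; rewrite P1 inE => /eqP->.
move: wfP; rewrite /wf_params (negbTE P1) /= => /and3P[_ _ /allP geP].
case/flatten_mapP: sP => p /geP/andP[p_ge2 _]; rewrite mem_nseq => /andP[_ /eqP->].
exact: ltnW.
Qed.

(** * Elementary replacements *)

Lemma trivial_OA s : exists B : array s, is_OA [:: (1, 1)] B.
Proof.
exists [:: Tagged (fun l => {ffun 'I_s -> 'I_l}) [ffun x : 'I_s => (ord0 : 'I_1)]].
split=> //=; rewrite andbT; apply/balancedP => a.
rewrite mul1n -[RHS](card_ord s) -cardsT; apply: eq_card => x.
by rewrite !inE; apply/eqP; rewrite [LHS]ord1 [RHS]ord1.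
Qed.

Lemma identity_OA s : 0 < s -> exists B : array s, is_OA [:: (s, 1)] B.
Proof.
move=> s_gt0; exists [:: Tagged (fun l => {ffun 'I_s -> 'I_l}) [ffun x : 'I_s => x]].
split=> //=; first by rewrite /wf_params /=; case: s s_gt0 => [|[|s]].
rewrite andbT; apply/balancedP => a.
rewrite (_ : [set x | _] = [set (a : 'I_s)]) ?cards1 ?muln1 //.
by apply/setP => x; rewrite !inE ffunE.
Qed.

(** Permutations are checked by counting an arbitrary predicate [p]; in the goals concerned only its
    values at 2, 4 and 8 matter besides the count on the common rest. *)
Local Ltac perm_count :=
  let p := fresh "p" in apply/permP => p; rewrite /= ?count_cat ?count_nseq /= ?count_cat ?count_nseq;
  case: (p 2); case: (p 4); case: (p 8); lia.

Section Reach.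

Variables (N : nat) (A : array N).

Lemma reaches_replace s M R (B : array s) M' :
  is_OA R B -> perm_eq (drop_ones (column_levels R ++ M)) M' ->
  reaches A (s :: M) -> reaches A M'.
Proof.
move=> oaB permM' reachA.
have [A' [AA' strA' eqM']] := reaches_step reachA oaB permM'.
by exists A'; split=> //; rewrite eqM'.
Qed.

(** Deletion is replacement by the trivial array. For empty [M] the zero column would stay, which is
    the case of [reaches_trivial]. *)
Lemma reaches_delete s (M : seq nat) : 1 \notin M -> M != [::] ->
  reaches A (s :: M) -> reaches A M.
Proof.
move=> M1 Mn; have [B oaB] := trivial_OA s; apply: reaches_replace oaB _.
have -> : drop_ones (column_levels [:: (1, 1)] ++ M) = drop_ones M.
  by rewrite /drop_ones /= (_ : filter _ M = M) ?(drop_ones_id M1) //;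
    [case: M Mn {M1} | apply/all_filterP/allP => k kM; apply: contraNneq M1 => <-].
by rewrite drop_ones_id.
Qed.

Lemma reaches_trivial s : reaches A [:: s] -> reaches A [:: 1].
Proof. by have [B oaB] := trivial_OA s; apply: reaches_replace oaB _. Qed.

Lemma reaches_split s (M : seq nat) R (B : array s) :
  is_OA R B -> 1 \notin column_levels R -> 1 \notin M ->
  reaches A (s :: M) -> reaches A (column_levels R ++ M).
Proof.
move=> oaB R1 M1; apply: reaches_replace oaB _.
by rewrite drop_ones_id // mem_cat negb_or R1.
Qed.

Lemma reaches_delete_2 n a (M : seq nat) : 1 \notin M -> 0 < a + size M ->
  reaches A (nseq (a + n) 2 ++ M) -> reaches A (nseq a 2 ++ M).
Proof.
move=> M1 gt0; elim: n => [|n IH]; rewrite ?addn0 // addnS => reachA.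
apply: IH; apply: (@reaches_delete 2) => //.
- by rewrite mem_cat negb_or mem_nseq andbF.
- by rewrite -size_eq0 size_cat size_nseq -lt0n (leq_trans gt0) // leq_add2r leq_addr.
Qed.

Lemma reaches_split_4 n a b (M : seq nat) : 1 \notin M ->
  reaches A (nseq a 2 ++ nseq (b + n) 4 ++ M) ->
  reaches A (nseq (a + 3 * n) 2 ++ nseq b 4 ++ M).
Proof.
move=> M1; elim: n a => [|n IH] a; rewrite ?addn0 // addnS => reachA.
have -> : a + 3 * n.+1 = a + 3 + 3 * n by lia.
apply: IH; apply: (@reaches_perm _ _ (column_levels [:: (2, 3)] ++
  (nseq a 2 ++ nseq (b + n) 4 ++ M))).
  by perm_count.
apply: (reaches_split OA4_2) => //.
  by rewrite !mem_cat !mem_nseq !andbF.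
apply: reaches_perm reachA.
by perm_count.
Qed.

(** Split the [b - b'] surplus 4-level columns into three 2-level columns each, then delete the
    surplus 2-level columns. *)
Lemma reaches_2_4 a b a' b' (M : seq nat) : 1 \notin M -> 0 < a' + b' + size M ->
  b' <= b -> a' + 3 * b' <= a + 3 * b ->
  reaches A (nseq a 2 ++ nseq b 4 ++ M) ->
  reaches A (nseq a' 2 ++ nseq b' 4 ++ M).
Proof.
move=> M1 gt0 le_b le_a reachA.
apply: (@reaches_delete_2 (a + 3 * (b - b') - a')).
- by rewrite mem_cat negb_or mem_nseq andbF.
- by rewrite size_cat size_nseq addnA.
rewrite subnKC; last by lia.
by apply: reaches_split_4 => //; rewrite subnKC.
Qed.

Lemma reaches_split_8 a b c (M : seq nat) : 1 \notin M ->
  reaches A (nseq a 2 ++ nseq b 4 ++ nseq c.+1 8 ++ M) ->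
  reaches A (nseq (a + 4) 2 ++ nseq b.+1 4 ++ nseq c 8 ++ M).
Proof.
move=> M1 reachA; apply: (@reaches_perm _ _ (column_levels [:: (2, 4); (4, 1)] ++
  (nseq a 2 ++ nseq b 4 ++ nseq c 8 ++ M))).
  by perm_count.
apply: (reaches_split OA8_2_4) => //.
  by rewrite !mem_cat !mem_nseq !andbF.
apply: reaches_perm reachA.
by perm_count.
Qed.

Lemma reaches_split_16 b : reaches A (nseq b 4 ++ [:: 16]) ->
  reaches A (nseq (b + 5) 4).
Proof.
move=> reachA; apply: (@reaches_perm _ _ (column_levels [:: (4, 5)] ++ nseq b 4)).
  by perm_count.
apply: (reaches_split OA16_4) => //; first by rewrite mem_nseq andbF.
by apply: reaches_perm reachA; rewrite perm_catC.
Qed.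

End Reach.

(* The identity replacement at the end serves to reorder the columns. *)
Lemma reaches_dominated N P Q (A : array N) M :
  is_OA Q A -> wf_params P -> perm_eq M (column_levels P) ->
  reaches A M -> dominated N P Q.
Proof.
move=> oaA wfP permM reachA.
have [s sP] : exists s, s \in column_levels P.
  by case: column_levels (column_levels_neq_nil wfP) => // s L _; exists s; rewrite mem_head.
have [B oaB] := identity_OA (column_levels_gt0 wfP sP).
have permP' := perm_to_rem sP.
have reachA' : reaches A (s :: rem s (column_levels P)).
  by apply: reaches_perm reachA; apply: perm_trans permM _.
have [|A' [AA' strA' levA']] := reaches_step reachA' oaB (M' := column_levels P).
  rewrite -[X in perm_eq _ X](drop_ones_column_levels wfP) perm_sym.
  exact: perm_drop_ones.
by exists A, A'; split=> //; case/andP: strA'; split.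
Qed.

Lemma dominated_top P : P \in seven_params -> dominated 64 P [:: (64, 1)].
Proof.
move=> P7; have [A oaA] := @identity_OA 64 isT; have oaP := seven_OA P7.
have wfP : wf_params P by case: oaP.
apply: (@reaches_dominated _ _ _ A (column_levels P)) => //.
apply: (reaches_replace (M := [::]) oaP); last first.
  exists A; split; [exact: rt_refl | exact: is_OA_strength2 oaA |].
  by case: oaA => _ ->.
by rewrite cats0 drop_ones_column_levels.
Qed.

(** * Classification of the feasible multisets *)

Lemma count_notdvd N M s : 0 < N -> OA_levels N M -> ~~ (s %| N) ->
  count_mem s M = 0.
Proof.
move=> N_gt0 oa; apply: contraNeq; rewrite -lt0n => s_gt0.
apply: OA_levels_dvd => //; apply: OA_levels_sub oa => k /=.
by have [<-|] := eqVneq s k.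
Qed.

Lemma count_square_notdvd N M s : 0 < N -> OA_levels N M -> ~~ (s * s %| N) ->
  count_mem s M <= 1.
Proof.
move=> N_gt0 oa; apply: contraNT; rewrite -ltnNge => s_gt1.
apply: OA_levels_dvd2 => //; apply: OA_levels_sub oa => k /=.
by have [<-|] := eqVneq s k.
Qed.

Lemma count_product_notdvd N M s t : 0 < N -> OA_levels N M -> s != t ->
  ~~ (s * t %| N) -> count_mem s M = 0 \/ count_mem t M = 0.
Proof.
move=> N_gt0 oa neq_st ndvd.
have [|s_gt0] := posnP (count_mem s M); first by left.
have [|t_gt0] := posnP (count_mem t M); first by right.
case/negP: ndvd; apply: OA_levels_dvd2 => //; apply: OA_levels_sub oa => k /=.
have [<-|_] := eqVneq s k; first by rewrite [t == s]eq_sym (negbTE neq_st).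
by have [<-|] := eqVneq t k.
Qed.

Lemma rao_bound_counts N M : 0 < N -> OA_levels N M ->
  count_mem 2 M + 3 * count_mem 4 M + 7 * count_mem 8 M + 15 * count_mem 16 M
    + 31 * count_mem 32 M + 63 * count_mem 64 M < N.
Proof.
move=> N_gt0 oa; apply: rao_bound => //; apply: OA_levels_sub oa => k.
rewrite !count_nseq_cat /= addn0.
have [->|_] := eqVneq k 2; first by lia.
have [->|_] := eqVneq k 4; first by lia.
have [->|_] := eqVneq k 8; first by lia.
have [->|_] := eqVneq k 16; first by lia.
have [->|_] := eqVneq k 32; first by lia.
have [->|_] := eqVneq k 64; first by lia.
by lia.
Qed.

Lemma dvd64 k : (k %| 64) = (k \in [:: 1; 2; 4; 8; 16; 32; 64]).
Proof.
have -> : (k %| 64) = (k \in divisors 64) by rewrite -dvdn_divisors.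
by [].
Qed.

Lemma perm_counts M : {subset M <= [:: 2; 4; 8; 16; 32]} ->
  perm_eq (nseq (count_mem 2 M) 2 ++ nseq (count_mem 4 M) 4 ++
    nseq (count_mem 8 M) 8 ++ nseq (count_mem 16 M) 16 ++
    nseq (count_mem 32 M) 32 ++ [::]) M.
Proof.
move=> subM; apply/allP => k _ /=; rewrite !count_nseq_cat /= addn0.
have [|k_notin] := boolP (k \in [:: 2; 4; 8; 16; 32]).
  by rewrite !inE => /or4P[|||/orP[]] /eqP-> /=; rewrite mul1n !mul0n ?addn0.
rewrite (count_memPn (contra (@subM k) k_notin)).
move: k_notin; rewrite !inE !negb_or ![k == _]eq_sym.
by case/and5P => /negbTE-> /negbTE-> /negbTE-> /negbTE-> /negbTE->.
Qed.

(** Necessary conditions purely on the counts, so that classification and maximality both become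
    linear arithmetic: Rao's bound, divisibility of 64 by products of two levels, and the six
    exclusions of 4- and 8-level columns. *)
Record feasible64 (M : seq nat) : Prop := Feasible64 {
  feasible_rao : count_mem 2 M + 3 * count_mem 4 M + 7 * count_mem 8 M
    + 15 * count_mem 16 M + 31 * count_mem 32 M + 63 * count_mem 64 M < 64;
  feasible_16_16 : count_mem 16 M <= 1;
  feasible_32_32 : count_mem 32 M <= 1;
  feasible_32_4 : count_mem 32 M = 0 \/ count_mem 4 M = 0;
  feasible_32_8 : count_mem 32 M = 0 \/ count_mem 8 M = 0;
  feasible_32_16 : count_mem 32 M = 0 \/ count_mem 16 M = 0;
  feasible_16_8 : count_mem 16 M = 0 \/ count_mem 8 M = 0;
  feasible_4_8 : all (fun k => (count_mem 4 M < k.1) || (count_mem 8 M < k.2))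
    [:: (18, 1); (16, 2); (11, 4); (9, 5); (3, 7); (2, 8)] }.

Lemma OA_levels_feasible64 M : OA_levels 64 M -> feasible64 M.
Proof.
move=> oa; split; try exact: (count_product_notdvd _ oa).
- exact: rao_bound_counts.
- exact: (count_square_notdvd _ oa).
- exact: (count_square_notdvd _ oa).
apply/allP => -[k4 k8] k48 /=; rewrite -[_ || _]negbK negb_or -!leqNgt.
by apply/negP => /andP[le4 le8]; apply: OA64_no_4_8 oa k48 le4 le8.
Qed.

Lemma column_levels_sub64 P : OA_levels 64 (column_levels P) -> wf_params P ->
  P != [:: (1, 1)] -> {subset column_levels P <= [:: 2; 4; 8; 16; 32; 64]}.
Proof.
move=> oa wfP P1 k kP; have : k \in [:: 1; 2; 4; 8; 16; 32; 64].
  rewrite -dvd64; apply: contraTT kP => ndvd.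
  by apply/count_memPn/(count_notdvd _ oa).
rewrite inE => /orP[/eqP k1|//].
by case/negP: (one_notin_column_levels wfP P1); rewrite -k1.
Qed.

(** A 64-level column alone has weight 63 in Rao's bound, which leaves no room for another
    nontrivial column. *)
Lemma count_64_eq0 P : OA_levels 64 (column_levels P) -> wf_params P ->
  P <> [:: (64, 1)] -> count_mem 64 (column_levels P) = 0.
Proof.
move=> oa wfP P_top; apply/eqP; rewrite -leqn0 leqNgt; apply/negP => gt64.
apply: P_top; have rao := feasible_rao (OA_levels_feasible64 oa).
have [c2 c4 c8 c16 c32] : [/\ count_mem 2 (column_levels P) = 0,
    count_mem 4 (column_levels P) = 0, count_mem 8 (column_levels P) = 0,
    count_mem 16 (column_levels P) = 0 & count_mem 32 (column_levels P) = 0].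
  by split; lia.
have c64 : count_mem 64 (column_levels P) = 1 by lia.
have P1 : P != [:: (1, 1)] by apply: contraTneq gt64 => ->.
apply: wf_params_inj => //; apply/allP => k.
rewrite mem_cat /= inE => k_in; have : k \in [:: 2; 4; 8; 16; 32; 64].
  by case/orP: k_in => [/(column_levels_sub64 oa wfP P1) // | /eqP->].
by rewrite !inE => /or4P[|||/or3P[]] /eqP->; rewrite ?c2 ?c4 ?c8 ?c16 ?c32 ?c64.
Qed.

Lemma realized_dominated P : realized 64 P -> P <> [:: (64, 1)] ->
  exists2 Q, Q \in seven_params & dominated 64 P Q.
Proof.
move=> [A oaA] P_top; have wfP : wf_params P by case: oaA.
have oa : OA_levels 64 (column_levels P).
  by exists A; [exact: is_OA_strength2 oaA | case: oaA].
have start Q : Q \in seven_params ->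
    reaches (map (linear_column 64) (spread_of Q)) (column_levels Q).
  move=> /seven_OA oaQ; exists (map (linear_column 64) (spread_of Q)).
  by split; [exact: rt_refl | exact: is_OA_strength2 oaQ | case: oaQ => _ ->].
(* Splitting the 16-level column gives 4^21, which serves for all multisets of levels 2 and 4 and
   for the trivial array. *)
have start_4 : reaches (map (linear_column 64) (spread_of [:: (4, 16); (16, 1)]))
    (nseq 0 2 ++ nseq 21 4 ++ [::]).
  exact: (@reaches_split_16 _ _ 16 (start [:: (4, 16); (16, 1)] isT)).
have [P1|P1] := eqVneq P [:: (1, 1)].
  exists [:: (4, 16); (16, 1)] => //.
  apply: (@reaches_dominated _ _ _ _ [:: 1] (seven_OA _)) => //; rewrite ?P1 //.
  by apply: (@reaches_trivial _ _ 2); apply: (@reaches_2_4 _ _ _ _ 1 0) start_4.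
have [rao f16 f32 f32_4 f32_8 f32_16 f16_8 /and5P[/= f1 f2 f3 f4 /and3P[f5 f6 _]]] :=
  OA_levels_feasible64 oa.
have no64 := count_64_eq0 oa wfP P_top.
have sub32 : {subset column_levels P <= [:: 2; 4; 8; 16; 32]}.
  move=> k kP; have := column_levels_sub64 oa wfP P1 kP; rewrite !inE => /or4P[|||/or3P[]] /eqP k_eq;
    rewrite k_eq ?orbT // in kP *.
  by move: kP; rewrite -has_pred1 has_count no64.
have := perm_counts sub32; have := column_levels_neq_nil wfP.
move: (count_mem 2 _) (count_mem 4 _) (count_mem 8 _) (count_mem 16 _) (count_mem 32 _)
  (count_mem 64 _) rao f16 f32 f32_4 f32_8 f32_16 f16_8 f1 f2 f3 f4 f5 f6 no64.
move=> n2 n4 n8 n16 n32 n64 rao f16 f32 f32_4 f32_8 f32_16 f16_8 f1 f2 f3 f4 f5 f6 no64.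
move=> nonnil permP.
(* Once the columns [L] of more than 4 levels are matched, only the numbers of 2- and 4-level
   columns remain to be compared. *)
have finish Q a b L : Q \in seven_params -> 1 \notin L ->
    perm_eq (nseq n2 2 ++ nseq n4 4 ++ L) (column_levels P) ->
    n4 <= b -> n2 + 3 * n4 <= a + 3 * b ->
    reaches (map (linear_column 64) (spread_of Q)) (nseq a 2 ++ nseq b 4 ++ L) ->
    exists2 Q, Q \in seven_params & dominated 64 P Q.
  move=> Q7 L1 permL le_b le_a reachQ; exists Q => //.
  apply: (reaches_dominated (seven_OA Q7) wfP permL).
  apply: reaches_2_4 reachQ => //.
  have := perm_size permL; rewrite !size_cat !size_nseq addnA => ->.
  by rewrite lt0n size_eq0.
have [n32_0|n32_gt0] := posnP n32; last first.
  have [? ? ? ?] : [/\ n32 = 1, n4 = 0, n8 = 0 & n16 = 0] by split; lia.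
  subst; apply: (@finish [:: (2, 32); (32, 1)] 32 0 [:: 32]) => //; first by lia.
  exact: start.
have [n16_0|n16_gt0] := posnP n16; last first.
  have [? ?] : n16 = 1 /\ n8 = 0 by split; lia.
  subst; apply: (@finish [:: (4, 16); (16, 1)] 0 16 [:: 16]) => //; try by lia.
  exact: start.
subst n32 n16 n64.
have start_8 Q a b c : Q \in seven_params ->
    column_levels Q = nseq a 2 ++ nseq b 4 ++ nseq c 8 ++ [::] ->
    reaches (map (linear_column 64) (spread_of Q))
      (nseq a 2 ++ nseq b 4 ++ nseq c 8 ++ [::]).
  by move=> Q7 <-; apply: start.
have : n8 < 10 by lia.
(* One case for each [n8] from 0 to 9. For 2 and 5 one 8-level column of 4^14 8^3 and 4^7 8^6 is
   split into 2^4 4; for 7 and 8 two columns and one column of 8^9 are split. *)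
case: n8 permP rao {f32_8 f16_8} f1 f2 f3 f4 f5 f6 => [|[|[|[|[|[|[|[|[|[|//]]]]]]]]]] permP rao f1 f2 f3 f4 f5 f6 _.
- by apply: (finish _ _ _ _ _ _ permP) start_4 => //; lia.
- by apply: (finish [:: (2, 5); (4, 17); (8, 1)] 5 17 _ _ _ permP) => //; [lia | lia | exact: start_8].
- apply: (finish [:: (4, 14); (8, 3)] 4 15 _ _ _ permP) => //; [lia | lia |].
  exact/(@reaches_split_8 _ _ 0 14)/start_8.
- by apply: (finish [:: (4, 14); (8, 3)] 0 14 _ _ _ permP) => //; [lia | lia | exact: start_8].
- by apply: (finish [:: (2, 5); (4, 10); (8, 4)] 5 10 _ _ _ permP) => //; [lia | lia | exact: start_8].
- apply: (finish [:: (4, 7); (8, 6)] 4 8 _ _ _ permP) => //; [lia | lia |].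
  exact/(@reaches_split_8 _ _ 0 7)/start_8.
- by apply: (finish [:: (4, 7); (8, 6)] 0 7 _ _ _ permP) => //; [lia | lia | exact: start_8].
- apply: (finish [:: (8, 9)] 8 2 _ _ _ permP) => //; [lia | lia |].
  exact/(@reaches_split_8 _ _ 4 1)/(@reaches_split_8 _ _ 0 0)/start_8.
- apply: (finish [:: (8, 9)] 4 1 _ _ _ permP) => //; [lia | lia |].
  exact/(@reaches_split_8 _ _ 0 0)/start_8.
- by apply: (finish [:: (8, 9)] 0 0 _ _ _ permP) => //; [lia | lia | exact: start_8].
Qed.

(** * Maximality of the seven parameter sets *)

Definition same_levels (M M' : seq nat) : Prop :=
  forall k, k != 1 -> count_mem k M = count_mem k M'.

(** The [n], [m] and [p] count levels in the array before the step, in the array replacing an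
    [s]-level column, and in the result. Either the replacing array is one [s]-level column and
    nothing changes, or the counts [n] violate one of the constraints. *)
Lemma saturated_predecessor s n2 n4 n8 n16 n32 m2 m4 m8 m16 m32 p2 p4 p8 p16 p32 :
  s \in [:: 1; 2; 4; 8; 16; 32] ->
  (p2, p4, p8, p16, p32) \in [:: (5, 17, 1, 0, 0); (0, 14, 3, 0, 0);
    (5, 10, 4, 0, 0); (0, 7, 6, 0, 0); (0, 0, 9, 0, 0); (0, 16, 0, 1, 0);
    (32, 0, 0, 0, 1)] ->
  n2 + 3 * n4 + 7 * n8 + 15 * n16 + 31 * n32 < 64 ->
  n32 <= 1 -> (n32 = 0 \/ n4 = 0) -> (n32 = 0 \/ n8 = 0) ->
  (n32 = 0 \/ n16 = 0) -> n16 <= 1 -> (n16 = 0 \/ n8 = 0) -> 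
  (n4 < 18) || (n8 < 1) -> (n4 < 16) || (n8 < 2) ->
  (n4 < 11) || (n8 < 4) -> (n4 < 9) || (n8 < 5) ->
  m2 + 3 * m4 + 7 * m8 + 15 * m16 + 31 * m32 < s ->
  (16 %| s) || (m4 <= 1) -> (64 %| s) || (m8 <= 1) ->
  (32 %| s) || (m4 == 0) || (m8 == 0) ->
  p2 + (s == 2) = n2 + m2 -> p4 + (s == 4) = n4 + m4 -> p8 + (s == 8) = n8 + m8 ->
  p16 + (s == 16) = n16 + m16 -> p32 + (s == 32) = n32 + m32 ->
  [/\ n2 = p2, n4 = p4, n8 = p8, n16 = p16 & n32 = p32].
Proof.
move=> s_in p_in rao f32 f32_4 f32_8 f32_16 f16 f16_8 f1 f2 f3 f4.
move=> raoM m44 m88 m48 c2 c4 c8 c16 c32.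
have p_wt : p2 + 3 * p4 + 7 * p8 + 15 * p16 + 31 * p32 = 63.
  by move: p_in; rewrite !inE => /or4P[|||/or4P[]] /eqP[-> -> -> -> ->].
(* A replacement adds the weight of the new columns and removes [s - 1]; since the result has weight
   63 and the predecessor at most 63, the new columns weigh at least [s - 1], and Rao's bound gives
   equality. *)
have m_wt : m2 + 3 * m4 + 7 * m8 + 15 * m16 + 31 * m32 = s.-1.
  move: s_in; rewrite !inE => /or4P[|||/or3P[]] /eqP Es;
    by rewrite Es /= in raoM c2 c4 c8 c16 c32 *;
       clear -rao raoM p_wt c2 c4 c8 c16 c32; lia.
move: s_in {rao raoM p_wt}; rewrite !inE => /or4P[|||/or3P[]] /eqP Es; subst s; simpl in *.
- by clear - m_wt c2 c4 c8 c16 c32; split; lia.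
- by clear - m_wt c2 c4 c8 c16 c32; split; lia.
(* For [s = 4] the other option is 2^3, whose predecessors contain 4^18 8^1, 4^11 8^4 or both levels
   4 and 32. *)
- have [m4_0|m4_gt0] := posnP m4; last first.
    by clear - m4_gt0 m_wt c2 c4 c8 c16 c32; split; lia.
  move: p_in {f16 c16 m44 m88 m48 f32 f32_8 f32_16 f16_8 f2 f4}; rewrite !inE.
  by case/or4P => [|||/or4P[]] /eqP[? ? ? ? ?]; subst; lia.
(* For [s = 8] the other options are 2^7 and 2^4 4; the predecessors contain 4^16 8^2, 4^9 8^5 or
   both levels 8 and 32, unless the result has too few 2-level columns. *)
- have [m8_0|m8_gt0] := posnP m8; last first.
    by clear - m8_gt0 m_wt c2 c4 c8 c16 c32; split; lia.
  move: p_in {f16 c16 m88 m48 f32 f32_4 f32_16 f16_8 f1 f3}; rewrite !inE.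
  by case/or4P => [|||/or4P[]] /eqP[? ? ? ? ?]; subst; lia.
- have [m16_0|m16_gt0] := posnP m16; last first.
    by clear - m16_gt0 m_wt c2 c4 c8 c16 c32; split; lia.
  move: p_in {m44 f32 f32_4 f32_8 f1 f2 f3 f4}; rewrite !inE.
  by case/or4P => [|||/or4P[]] /eqP[? ? ? ? ?]; subst; lia.
- have [m32_0|m32_gt0] := posnP m32; last first.
    by clear - m32_gt0 m_wt c2 c4 c8 c16 c32; split; lia.
  move: p_in {m44 m88 m48 f16 f16_8 f1 f2 f3 f4}; rewrite !inE.
  by case/or4P => [|||/or4P[]] /eqP[? ? ? ? ?]; subst; lia.
Qed.

(* All seven parameter sets meet Rao's bound, so a replacement ending in one of
   them must use a saturated array [B]; the other predecessors this allows are
   infeasible. *)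
Lemma replacement_backward (A A' : array 64) P :
  P \in seven_params -> strength2 A -> count_mem 64 (map (@levels 64) A) = 0 ->
  expansive_replacement A A' ->
  same_levels (map (@levels 64) A') (column_levels P) ->
  same_levels (map (@levels 64) A) (column_levels P).
Proof.
move=> P7 strA no64 repl sameA'.
have oaA : OA_levels 64 (map (@levels 64) A) by exists A.
have oaA' : OA_levels 64 (map (@levels 64) A').
  by exists A' => //; apply: expansive_replacement_strength2 repl strA.
have [s [M [sA oaM countA']]] := expansive_replacement_counts repl.
have s64 : s \in [:: 1; 2; 4; 8; 16; 32; 64].
  rewrite -dvd64; apply: contraTT sA => ndvd.
  by apply/count_memPn/(count_notdvd _ oaA).
have s_gt0 : 0 < s by move: s64; rewrite -dvd64; case: s {sA oaM countA'}.
have countA k : k != 1 -> count_mem k (column_levels P) + (s == k) =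
    count_mem k (map (@levels 64) A) + count_mem k M.
  by move=> k1; rewrite -sameA' // countA'.
have m_44 : (4 * 4 %| s) || (count_mem 4 M <= 1).
  by have [//|ndvd] := boolP (4 * 4 %| s); rewrite (count_square_notdvd _ oaM ndvd).
have m_88 : (8 * 8 %| s) || (count_mem 8 M <= 1).
  by have [//|ndvd] := boolP (8 * 8 %| s); rewrite (count_square_notdvd _ oaM ndvd).
have m_48 : (4 * 8 %| s) || (count_mem 4 M == 0) || (count_mem 8 M == 0).
  have [//|ndvd] := boolP (4 * 8 %| s).
  by have [|->|->] := count_product_notdvd s_gt0 oaM _ ndvd; rewrite ?orbT.
have raoM := rao_bound_counts s_gt0 oaM.
have [rao f16 f32 f32_4 f32_8 f32_16 f16_8 /and5P[/= f1 f2 f3 f4 _]] :=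
  OA_levels_feasible64 oaA.
have s32 : s \in [:: 1; 2; 4; 8; 16; 32].
  apply: contraTT sA => s_notin; suff -> : s = 64 by apply/count_memPn.
  have : s \in rcons [:: 1; 2; 4; 8; 16; 32] 64 := s64.
  by rewrite mem_rcons inE (negbTE s_notin) orbF => /eqP.
have same5 : [/\ count_mem 2 (map (@levels 64) A) = count_mem 2 (column_levels P),
    count_mem 4 (map (@levels 64) A) = count_mem 4 (column_levels P),
    count_mem 8 (map (@levels 64) A) = count_mem 8 (column_levels P),
    count_mem 16 (map (@levels 64) A) = count_mem 16 (column_levels P) &
    count_mem 32 (map (@levels 64) A) = count_mem 32 (column_levels P)].
  apply: (saturated_predecessor s32 _ _ f32 f32_4 f32_8 f32_16 f16 f16_8 f1 f2 f3 f4
    _ m_44 m_88 m_48); rewrite ?countA //.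
  - by move: P7; rewrite !inE => /or4P[|||/or4P[]] /eqP->.
  - by apply: leq_ltn_trans rao; rewrite leq_addr.
  - by apply: leq_ltn_trans raoM; rewrite leq_addr.
move=> k k1.
have [|k64] := boolP (k \in [:: 2; 4; 8; 16; 32]).
  case: same5 => e2 e4 e8 e16 e32.
  by rewrite !inE => /or4P[|||/orP[]] /eqP->.
have [->|k_64] := eqVneq k 64.
  by rewrite no64; move: P7; rewrite !inE => /or4P[|||/or4P[]] /eqP->.
have ndvd : ~~ (k %| 64).
  rewrite dvd64; move: k64; rewrite !inE !negb_or k1 k_64.
  by case/and5P => -> -> -> -> ->.
by rewrite (count_notdvd _ oaA ndvd) // -sameA' // (count_notdvd _ oaA' ndvd).
Qed.

(** Induction along the chain from its start: the absence of 64-level columns persists, so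
    [replacement_backward] applies at each step. *)
Lemma chain_backward (A A' : array 64) P :
  P \in seven_params -> clos_refl_trans (array 64) (@expansive_replacement 64) A A' ->
  strength2 A -> count_mem 64 (map (@levels 64) A) = 0 ->
  same_levels (map (@levels 64) A') (column_levels P) ->
  same_levels (map (@levels 64) A) (column_levels P).
Proof.
move=> P7 AA'; have {}AA' := clos_rt_rt1n _ _ _ _ AA'.
elim: AA' => // {A A'} A A1 A' step _ IH strA no64 sameA'.
apply: (replacement_backward P7 strA no64 step); apply: IH => //.
  exact: expansive_replacement_strength2 step strA.
have [s [M [sA oaM]]] := expansive_replacement_counts step.
move=> /(_ 64 isT); rewrite no64 => count64.
have s_dvd : s %| 64.
  apply: contraTT sA => ndvd; apply/count_memPn.
  by apply: (@count_notdvd 64) => //; exists A.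
have s_neq64 : s != 64.
  by apply: contraTneq sA => ->; apply/count_memPn.
(* The replacing array has [s] runs with [s] a proper divisor of 64, so none of its columns can have
   64 levels. *)
suff m64 : count_mem 64 M = 0 by move: count64; rewrite m64 (negbTE s_neq64) /= !addn0.
apply: (count_notdvd _ oaM); first exact: dvdn_gt0 s_dvd.
by apply: contra s_neq64 => dvd_s; rewrite eqn_dvd s_dvd.
Qed.

Lemma dominated_maximal P R : P \in seven_params -> dominated 64 P R ->
  R <> [:: (64, 1)] -> P = R.
Proof.
move=> P7 [A [A' [oaA oaA' AA']]] R_top.
have strA := is_OA_strength2 oaA.
have [wfR levA _ _] := oaA; have [wfP levA' _ _] := oaA'.
have oaR : OA_levels 64 (column_levels R) by exists A.
have P1 : P != [:: (1, 1)] by apply: contraTneq P7 => ->.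
have same : same_levels (column_levels R) (column_levels P).
  rewrite -levA; apply: chain_backward AA' strA _ _ => //.
    by rewrite levA; apply: count_64_eq0.
  by rewrite levA'.
(* [same_levels] ignores level 1, so the trivial parameter set has to be excluded separately. *)
have R1 : R != [:: (1, 1)].
  apply/eqP => R1; have := column_levels_neq_nil wfP.
  have := one_notin_column_levels wfP P1.
  case E: (column_levels P) => [//|k L]; rewrite inE negb_or => /andP[k1 _] _.
  have := same k; rewrite eq_sym k1 R1 E /= eqxx => /(_ isT).
  by rewrite (negbTE k1).
apply: wf_params_inj => //; apply/allP => k _ /=.
have [->|k1] := eqVneq k 1; last by rewrite same.
by rewrite !(count_memPn _) // one_notin_column_levels.
Qed.

Theorem theorem6 :
  (forall P : params, dual_atom 64 P <-> P \in seven_params) /\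
  (forall P : params, P \in seven_params ->
     exists A : array 64, is_OA P A /\ geometric A).
Proof.
have not_top P : P \in seven_params -> P <> [:: (64, 1)] by move=> P7 P_top; rewrite P_top in P7.
have real P : P \in seven_params -> realized 64 P.
  by move=> P7; exists (map (linear_column 64) (spread_of P)); apply: seven_OA.
split=> [P | P P7]; last first.
  exists (map (linear_column 64) (spread_of P)); split; first exact: seven_OA.
  apply: linear_columns_geometric.
  by have /and3P[] := allP spread_of_check P P7.
split=> [[realP _ [domP P_top] no_mid] | P7].
  (* A dual atom lies below one of the seven; were it different, that one would lie strictly between
     it and the maximum. *)
  have [Q Q7 domPQ] := realized_dominated realP P_top.
  have [-> //|/eqP neqPQ] := eqVneq P Q; case: no_mid; exists Q; split=> //.
  - exact: real.
  - by split; [exact: dominated_top | exact: not_top].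
split; [exact: real | exact: identity_OA | |].
  by split; [exact: dominated_top | exact: not_top].
case=> R [_ [domPR neqPR] [_ R_top]].
exact: neqPR (dominated_maximal P7 domPR R_top).
Qed.
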